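(* Suppose that for every integer $p\ge 1$ and all real-rooted polynomials $P,Q\in\mathbb{R}[X]$ with $\deg P=\deg Q=p$, the polynomial $\sum_{k=0}^p P^{(k)}Q^{(p-k)}$ is real-rooted. Then for all integers $n\ge p\ge 1$ and all $(a_0,\ldots,a_p)\in[0,\infty)^{p+1}$ such that the polynomial $$\sum_{k=0}^p a_k\binom{n}{k}X^k$$ is real-rooted, the function $\left(a_0+a_1\sigma_1+\cdots+a_p\sigma_p\right)^{1/p}$ is concave on $(0,\infty)^n$.
   Context: $\sigma_k(x)=\sum_{i_1<\cdots<i_k}x_{i_1}\cdots x_{i_k}$ is the $k$-th elementary symmetric polynomial in the coordinates of $x\in\mathbb{R}^n$ ($\sigma_0=1$). $P^{(k)}$ is the $k$-th derivative of $P$. A real polynomial is real-rooted if all its complex roots are real. *)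

(* Defs.v *)
From mathcomp Require Import all_boot all_order all_algebra.
From mathcomp Require Import complex.
From mathcomp Require Import all_classical all_reals all_analysis.
(* The notations of mpoly clash with those of the analysis library. *)
From mathcomp Require Import -(notations) mpoly.

Set Implicit Arguments.
Unset Strict Implicit.
Unset Printing Implicit Defensive.

Import Order.TTheory GRing.Theory Num.Theory.
Import numFieldNormedType.Exports.

Local Open Scope classical_set_scope.
Local Open Scope ring_scope.

(* Every complex number is a root of the zero polynomial, which is therefore
   not real-rooted. *)
Definition real_rooted (R : realType) (P : {poly R}) : Prop :=
  forall z : R[i],
    root (map_poly (real_complex R) P) z -> complex.Im z = 0.

Definition sigma (R : realType) (n k : nat) (x : 'rV[R]_n) : R :=
  meval (fun i => x ord0 i) (mesym n R k).

Definition positive_orthant (R : realType) (n : nat) : set 'rV[R]_n :=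
  [set x : 'rV[R]_n | forall i, 0 < x ord0 i].

(* As with [convex_function], the convexity of [D] is not part of the
   definition. *)
Definition concave_function (R : realType) (E : lmodType R)
    (D : set (convex_lmodType E)) (f : convex_lmodType E -> R^o) : Prop :=
  convex_function D (fun x => - f x).

(* Main.v *)
Require Import Defs.
From mathcomp Require Import all_boot all_order all_algebra.
From mathcomp Require Import zify ring lra.
From mathcomp Require Import complex.
From mathcomp Require Import all_classical all_reals all_analysis.
From mathcomp Require Import -(notations) mpoly.

Set Implicit Arguments.
Unset Strict Implicit.
Unset Printing Implicit Defensive.

Import Order.TTheory GRing.Theory Num.Theory.
Import numFieldNormedType.Exports.

Local Open Scope classical_set_scope.
Local Open Scope ring_scope.

(* A symmetric multiaffine polynomial f = sum_k a_k sigma_k is the polarization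
   of A(X) = sum_k a_k 'C(n, k) X^k, whose roots are real and nonpositive. On a
   line t |-> y + t (x - y) with x, y in the positive orthant, a nonreal zero
   tau of f would have all the points y_i + tau (x_i - y_i) in an open
   half-plane, bounded by a line through 0, that misses (-oo, 0]: this
   contradicts the Grace-Walsh-Szego theorem, obtained here by iterating
   Laguerre's theorem on polar derivatives. So f is real-rooted of degree at
   most p on the segment, hence a product of p positive affine functions of t,
   and Mahler's inequality gives the concavity of its p-th root. *)

(** * Polarization of a coefficient sequence *)

(* [polarize s b] is [sum_k b_k e_k(s)]: the recursion comes from
   [e_k(z :: s) = e_k(s) + z e_(k-1)(s)]. *)
Fixpoint polarize (S : nzRingType) (s : seq S) (b : nat -> S) : S :=
  if s is z :: s' then polarize s' (fun k => b k + z * b k.+1) else b 0.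

Lemma eq_polarize (S : nzRingType) (s : seq S) (b b' : nat -> S) :
  b =1 b' -> polarize s b = polarize s b'.
Proof.
elim: s b b' => [|z s IHs] b b' eqb /=; first exact: eqb.
by apply: IHs => k; rewrite !eqb.
Qed.

Lemma rmorph_polarize (S S' : nzRingType) (f : {rmorphism S -> S'})
    (s : seq S) (b : nat -> S) :
  f (polarize s b) = polarize (map f s) (f \o b).
Proof.
elim: s b => [|z s IHs] b //=; rewrite IHs.
by apply: eq_polarize => k /=; rewrite rmorphD rmorphM.
Qed.

Lemma polarizeE (S : comNzRingType) (s : seq S) (b : nat -> S) :
  polarize s b =
  \sum_(k < (size s).+1) b k * (\prod_(z <- s) (1 + z *: 'X) : {poly S})`_k.
Proof.
elim: s b => [|z s IHs] b /=; first by rewrite big_ord1 big_nil coef1 mulr1.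
rewrite IHs big_cons mulrDl mul1r.
set P := \prod_(w <- s) _.
(* This degree bound kills the extra top term when the sum over the coefficients of [P] gets the
   longer index range. *)
have szP : (size P <= (size s).+1)%N.
  rewrite {}/P; elim: s {IHs} => [|w s IHs]; first by rewrite big_nil size_poly1.
  rewrite big_cons (leq_trans (size_polyMleq _ _)) //.
  have szw : (size (1 + w *: 'X : {poly S})%R <= 2)%N.
    rewrite (leq_trans (size_polyD _ _)) // geq_max size_poly1 /=.
    by rewrite (leq_trans (size_scale_leq _ _)) // size_polyX.
  by rewrite -subn1 leq_subLR (leq_trans (leq_add szw IHs)).
under [LHS]eq_bigr do rewrite mulrDl.
under [RHS]eq_bigr do rewrite coefD -scalerAl coefZ coefXM mulrDr.
rewrite !big_split /=; congr (_ + _).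
  by rewrite [RHS]big_ord_recr /= [P`__]nth_default // mulr0 addr0.
rewrite [RHS]big_ord_recl /= !mulr0 add0r; apply: eq_bigr => i _.
by rewrite /bump /= mulrA [b _ * z]mulrC.
Qed.

Lemma polarize_gt0 (S : numDomainType) (s : seq S) (b : nat -> S) k :
  (forall z, z \in s -> 0 < z) -> (forall i, 0 <= b i) ->
  (k <= size s)%N -> 0 < b k -> 0 < polarize s b.
Proof.
elim: s b k => [|z s IHs] b k s_gt0 b_ge0 /=.
  by rewrite leqn0 => /eqP->.
move=> le_k bk_gt0; have z_gt0 : 0 < z by exact/s_gt0/mem_head.
have zb_ge0 i : 0 <= z * b i by rewrite mulr_ge0 // ltW.
(* Absorbing [z] moves the positive coefficient from index [k] to [k.-1]; for [k = 0] it stays in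
   place. *)
apply: (IHs _ k.-1) => [w ws|i||]; first by apply: s_gt0; rewrite inE ws orbT.
- by rewrite addr_ge0.
- by case: k le_k {bk_gt0}.
case: k {le_k} bk_gt0 => [|k] bk_gt0 /=; first by rewrite ltr_wpDr.
by rewrite ltr_wpDl // mulr_gt0.
Qed.

(** The bound on [b k] means degree at most [p - k], and [b k = 0] for [k > p]; adding an affine
    multiple of [b k.+1] to [b k] preserves it. *)
Lemma size_polarize (S : idomainType) (s : seq {poly S}) (b : nat -> {poly S}) p :
  (forall q, q \in s -> size q <= 2)%N ->
  (forall k, size (b k) <= p.+1 - k)%N -> (size (polarize s b) <= p.+1)%N.
Proof.
elim: s b => [|q s IHs] b szs szb /=; first by rewrite (leq_trans (szb _)).
apply: IHs => [r rs|k]; first by apply: szs; rewrite inE rs orbT.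
rewrite (leq_trans (size_polyD _ _)) // geq_max szb /=.
(* For [b k.+1 = 0], [size_polyMleq] may only bound the size by 1, too weak once [k > p]. *)
have [->|bk_neq0] := eqVneq (b k.+1) 0; first by rewrite mulr0 size_poly0.
rewrite (leq_trans (size_polyMleq _ _)) //.
have := szs q (mem_head _ _); have := szb k.+1.
by move: bk_neq0; rewrite -size_poly_gt0; lia.
Qed.

(** * Laguerre's theorem and the Grace-Walsh-Szego theorem *)

Section GraceWalshSzego.
Variable C : numClosedFieldType.
Implicit Types (a b c z : C).

(** [a^*] is the mirror image of [a] in the real axis, so the points at least as close to it as to
    [a] form the closed lower half-plane. *)
Lemma ler_norm_conjB a b : 0 < 'Im a -> (`|a^* - b| <= `|a - b|) = ('Im b <= 0).
Proof.
move=> a_gt0; rewrite -ler_sqr ?nnegrE // !normC2_Re_Im.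
rewrite !raddfB /= Re_conj Im_conj lerD2l -subr_ge0.
have -> : ('Im a - 'Im b) ^+ 2 - (- 'Im a - 'Im b) ^+ 2 =
  (- 'Im b) * (4 * 'Im a) by ring.
by rewrite pmulr_lge0 ?mulr_gt0 // oppr_ge0.
Qed.

(* The hypothesis on [u] says that each factor [1 + u / (z - r)] has modulus
   at most [1]. *)
Lemma log_deriv_disc (rs : seq C) z u :
  (forall r, r \in rs -> r != z /\ `|z - r + u| <= `|z - r|) ->
  exists2 W : C,
    (\prod_(r <- rs) ('X - r%:P))^`().[z] =
      (\prod_(r <- rs) ('X - r%:P)).[z] * W
    & `|(size rs)%:R + u * W| <= (size rs)%:R.
Proof.
elim: rs => [|r rs IHrs] rsP.
  by exists 0; rewrite ?big_nil ?derivC ?hornerC ?mulr0 ?addr0 ?normr0.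
have [|W dW leW] := IHrs; first by move=> w wrs; apply: rsP; rewrite inE wrs orbT.
have [r_neq ler] := rsP r (mem_head _ _).
have zr_neq0 : z - r != 0 by rewrite subr_eq0 eq_sym.
exists ((z - r)^-1 + W).
  rewrite big_cons derivM derivXsubC !hornerE /= dW.
  by field.
have -> : (size (r :: rs))%:R + u * ((z - r)^-1 + W) =
          ((size rs)%:R + u * W) + (z - r + u) / (z - r).
  by rewrite /= -natr1; field.
rewrite -[X in _ <= X]natr1.
rewrite (le_trans (ler_normD _ _)) // lerD //.
by rewrite normrM normfV ler_pdivrMr ?normr_gt0 // mul1r.
Qed.

(* Laguerre's theorem on polar derivatives. With [u] the vector from [z] to its
   mirror image [z + u] in the boundary line, [`|z + u - w| <= `|z - w|] fails
   for [w] in the half-plane but holds at the roots of [A], and [log_deriv_disc]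
   carries it over to the pole [z1] of a vanishing polar derivative. *)
Lemma polar_deriv_neq0 (A : {poly C}) m c z1 z :
  (size A <= m.+2)%N -> (forall w, 0 < 'Im (c * w) -> ~~ root A w) ->
  0 < 'Im (c * z1) -> 0 < 'Im (c * z) ->
  m.+1%:R * A.[z] + (z1 - z) * A^`().[z] != 0.
Proof.
move=> szA A_neq0 z1_gt0 z_gt0; apply/eqP => polar0.
have Az_neq0 : A.[z] != 0 by exact: A_neq0.
have c_neq0 : c != 0 by apply: contraTneq z_gt0 => ->; rewrite mul0r raddf0 ltxx.
have A_n0 : A != 0 by apply: contraNneq Az_neq0 => ->; rewrite horner0.
have [rs defA] := closed_field_poly_normal A.
have lc_neq0 : lead_coef A != 0 by rewrite lead_coef_eq0.
pose u := ((c * z)^* - c * z) / c.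
have [r rrs|W dW leW] := @log_deriv_disc rs z u.
  have rootr : root A r.
    by rewrite defA rootZ // root_prod_XsubC.
  have r_le0 : 'Im (c * r) <= 0.
    by rewrite real_leNgt ?Creal_Im ?real0 //; apply: contraTN rootr; exact: A_neq0.
  split; first by apply: contraTneq r_le0 => ->; rewrite -real_ltNge ?Creal_Im ?real0.
  rewrite -(@ler_pM2l _ `|c|) ?normr_gt0 // -!normrM.
  rewrite [X in _ <= X](_ : _ = `|c * z - c * r|); last by rewrite mulrBr.
  rewrite [X in X <= _](_ : _ = `|(c * z)^* - c * r|) ?ler_norm_conjB //.
  by congr (`|_|); rewrite /u; field.
have sz_rs : (size rs <= m.+1)%N.
  by move: szA; rewrite {1}defA size_scale // size_prod_XsubC.
(* If [A] has degree below [m.+1], each missing root counts as a root at infinity, with factor 1. *)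
have {}leW : `|m.+1%:R + u * W| <= m.+1%:R.
  rewrite -(subnK sz_rs) natrD -addrA.
  by rewrite (le_trans (ler_normD _ _)) // lerD // ger0_norm.
have {}dW : A^`().[z] = A.[z] * W.
  by rewrite defA derivZ !hornerZ dW mulrA.
have zW : (z - z1) * W = m.+1%:R.
  apply: (mulfI Az_neq0); apply/eqP; rewrite -subr_eq0 -oppr_eq0.
  by move: polar0; rewrite dW => <-; apply/eqP; ring.
suff : 'Im (c * z1) <= 0 by rewrite real_leNgt ?Creal_Im ?real0 // z1_gt0.
rewrite -(@ler_norm_conjB (c * z)) //.
rewrite -(@ler_pM2l _ m.+1%:R) ?ltr0Sn //.
apply: le_trans (ler_wpM2r (normr_ge0 _) leW).
rewrite -normrM -[X in X * _]normr_nat -normrM.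
have -> // : m.+1%:R * ((c * z)^* - c * z1) =
  (m.+1%:R + u * W) * (c * z - c * z1).
by rewrite -zW /u; field.
Qed.

Lemma coef_binomial_poly m (b : nat -> C) k :
  (\poly_(i < m.+1) (b i *+ 'C(m, i)))`_k = b k *+ 'C(m, k).
Proof.
rewrite coef_poly ltnS; case: leqP => // lt_mk.
by rewrite bin_small ?mulr0n.
Qed.

(** A polar derivative with pole [z1] acts on the coefficients as one step of [polarize], which
    drives the induction for Grace-Walsh-Szego. *)
Lemma polar_deriv_binomial_poly m (b : nat -> C) z1 :
  m.+1%:R *: \poly_(i < m.+2) (b i *+ 'C(m.+1, i)) +
    (z1%:P - 'X) * (\poly_(i < m.+2) (b i *+ 'C(m.+1, i)))^`() =
  m.+1%:R *: \poly_(i < m.+1) ((b i + z1 * b i.+1) *+ 'C(m, i)).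
Proof.
apply/polyP => k.
rewrite mulrBl coefD coefB coefCM coefXM !coefZ !coef_deriv !coef_binomial_poly.
(* [dn] rewrites the contribution of [z1] times the derivative, [dd] that of [m.+1] times the
   polynomial minus ['X] times its derivative. *)
have dn : m.+1%:R * 'C(m, k)%:R = k.+1%:R * 'C(m.+1, k.+1)%:R :> C.
  by rewrite -!natrM mul_bin_diag.
have dd : m.+1%:R * 'C(m, k)%:R = (m.+1%:R - k%:R) * 'C(m.+1, k)%:R :> C.
  have [le_km|lt_mk] := leqP k m.+1; first by rewrite -natrB // -!natrM mul_bin_down.
  by rewrite !bin_small ?mulr0 // ltnW.
have -> : (if k == 0 then 0 else b k.-1.+1 *+ 'C(m.+1, k.-1.+1) *+ k.-1.+1) =
  b k * 'C(m.+1, k)%:R * k%:R.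
  by case: k {dn dd} => [|k]; rewrite ?mulr0 // !mulr_natr.
have key (M M0 M1 K K1 x y : C) : M * M0 = K1 * M1 -> M * M0 = (M - K) * x ->
    forall y1, M * (y * x) + (z1 * (y1 * M1 * K1) - y * x * K) =
      M * ((y + z1 * y1) * M0).
  move=> e1 e2 y1; transitivity (y * (M * M0) + z1 * y1 * (M * M0)); last by ring.
  by rewrite {1}e2 e1; ring.
rewrite -[b k *+ _]mulr_natr -[b k.+1 *+ _]mulr_natr -[_ *+ k.+1]mulr_natr.
rewrite -[(b k + _) *+ _]mulr_natr.
exact: key dn dd _.
Qed.

(* Grace-Walsh-Szego for a half-plane bounded by a line through the origin. *)
Lemma polarize_neq0 (s : seq C) (b : nat -> C) c z0 :
  0 < 'Im (c * z0) -> (forall z, z \in s -> 0 < 'Im (c * z)) ->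
  (forall z, 0 < 'Im (c * z) ->
     ~~ root (\poly_(k < (size s).+1) (b k *+ 'C(size s, k))) z) ->
  polarize s b != 0.
Proof.
move=> z0_gt0; elim: s b => [|z1 s IHs] b s_gt0 A_neq0 /=.
  (* The polynomial is the constant [b 0]; [z0] witnesses that the half-plane is nonempty. *)
  have := A_neq0 z0 z0_gt0; rewrite /root horner_poly big_ord1 /=.
  by rewrite bin0 expr0 mulr1n mulr1.
apply: IHs => [z zs|z z_gt0]; first by apply: s_gt0; rewrite inE zs orbT.
have m_neq0 : (size s).+1%:R != 0 :> C by rewrite pnatr_eq0.
rewrite -(rootZ _ _ m_neq0) -polar_deriv_binomial_poly /root !hornerE /=.
apply: (polar_deriv_neq0 (c := c)) => //.
exact/s_gt0/mem_head.
Qed.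

End GraceWalshSzego.

(** * Elementary symmetric polynomials and Mahler's inequality *)

Section RealRooted.
Variable R : realType.

(** Expanding the product amounts to choosing the set [J] of factors that contribute [z *: 'X]; the
    sets of cardinal [k] give the coefficient of ['X^k]. *)
Lemma sigmaE n k (x : 'rV[R]_n) :
  sigma k x =
  (\prod_(z <- [seq x ord0 i | i <- enum 'I_n]) (1 + z *: 'X) : {poly R})`_k.
Proof.
rewrite big_map big_enum /=.
under eq_bigr do rewrite addrC.
rewrite bigA_distr coef_sum /sigma /mesym raddf_sum /= big_mkcond /=.
apply: eq_bigr => J _.
rewrite -big_mkcond /= scaler_prod prodr_const coefZ coefXn eq_sym.
case: ifP => _; last by rewrite mulr0.
rewrite mulr1 rmorph_prod /=; apply: eq_bigr => i _; exact: mevalXU.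
Qed.

Lemma sum_sigmaE n p (a : 'I_p.+1 -> R) (x : 'rV[R]_n) : (p <= n)%N ->
  \sum_(k < p.+1) a k * sigma k x =
  polarize [seq x ord0 i | i <- enum 'I_n] (fun k => oapp a 0 (insub k)).
Proof.
move=> le_pn; rewrite polarizeE size_map size_enum_ord.
pose F k := oapp a 0 (insub k) * sigma k x.
under [RHS]eq_bigr do rewrite -sigmaE -/(F _).
transitivity (\sum_(k < p.+1) F k).
  by apply: eq_bigr => k _; rewrite /F valK.
rewrite (big_ord_widen n.+1 F) // big_mkcond /=.
apply: eq_bigr => k _; case: ifP => // /negbT k_ge.
by rewrite /F insubN // mul0r.
Qed.

(** Mahler's inequality: apply AM-GM to the ratios [E i / G i] and [F i / G i], whose arithmetic
    means, weighted by [t] and [1 - t], add up to 1. *)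
Lemma geometric_mean_concave p (E F : 'I_p -> R) (t : R) :
  (0 < p)%N -> 0 <= t <= 1 -> (forall i, 0 < E i) -> (forall i, 0 < F i) ->
  t * (\prod_i E i) `^ p%:R^-1 + (1 - t) * (\prod_i F i) `^ p%:R^-1 <=
  (\prod_i (t * E i + (1 - t) * F i)) `^ p%:R^-1.
Proof.
move=> p_gt0 /andP[t_ge0 t_le1] E_gt0 F_gt0.
pose G i := t * E i + (1 - t) * F i.
have p_neq0 : p%:R != 0 :> R by rewrite pnatr_eq0 -lt0n.
have G_gt0 i : 0 < G i by have := E_gt0 i; have := F_gt0 i; rewrite /G; nra.
have prodG_gt0 : 0 < \prod_i G i by apply: prodr_gt0.
have AGM (H : 'I_p -> R) : (forall i, 0 < H i) ->
    (\prod_i H i) `^ p%:R^-1 <=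
    (\prod_i G i) `^ p%:R^-1 * ((\sum_i H i / G i) / p%:R).
  move=> H_gt0; set mu := (\sum_i _) / _.
  have mu_ge0 : 0 <= mu.
    by rewrite divr_ge0 ?ler0n ?sumr_ge0 // => i _; rewrite divr_ge0 ?ltW.
  have le_prod : \prod_i H i <= \prod_i G i * mu ^+ p.
    rewrite -ler_pdivrMl // mulrC -prodf_div.
    have [i _|/=] := @leif_AGM R 'I_p predT (fun i => H i / G i).
      by rewrite divr_ge0 ?ltW.
    by rewrite card_ord.
  have -> : mu = (mu ^+ p) `^ p%:R^-1.
    by rewrite -powR_mulrn // -powRrM mulfV // powRr1.
  rewrite -powRM; [|exact: ltW|exact: exprn_ge0].
  apply: ge0_ler_powR => //; rewrite ?invr_ge0 ?ler0n // nnegrE.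
    by apply: prodr_ge0 => i _; exact: ltW.
  by rewrite mulr_ge0 ?exprn_ge0 // ltW.
have lE := AGM _ E_gt0; have lF := AGM _ F_gt0.
have mean1 :
    t * ((\sum_i E i / G i) / p%:R) + (1 - t) * ((\sum_i F i / G i) / p%:R) = 1.
  rewrite !mulrA -mulrDl !mulr_sumr -big_split /= (eq_bigr (fun=> 1)) => [|i _].
    by rewrite sumr_const card_ord mulfV.
  by rewrite !mulrA -mulrDl -/(G i) mulfV // gt_eqF.
rewrite -[X in _ <= X]mulr1 -[X in _ <= _ * X]mean1.
rewrite mulrDr; apply: lerD.
  by rewrite mulrCA ler_wpM2l.
by rewrite mulrCA ler_wpM2l // subr_ge0.
Qed.

(** * Real-rooted polynomials: factorization and restriction to lines *)

Lemma real_rooted_factor (g : {poly R}) : real_rooted g ->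
  {rs : seq R | g = lead_coef g *: \prod_(r <- rs) ('X - r%:P)}.
Proof.
move=> g_rr; have [zs defg] := closed_field_poly_normal (map_poly (real_complex R) g).
exists (map (@complex.Re R) zs).
apply: (map_poly_inj (real_complex R)).
rewrite map_polyZ rmorph_prod /= big_map [LHS]defg lead_coef_map /=.
congr (_ *: _); rewrite !big_seq; apply: eq_bigr => z zs_z.
rewrite rmorphB /= map_polyX map_polyC /=; congr (_ - _%:P).
have : root (map_poly (real_complex R) g) z.
  by rewrite defg /root hornerZ mulf_eq0 -/(root _ z) root_prod_XsubC zs_z orbT.
by move/g_rr; case: z {zs_z} => u v /= ->.
Qed.

(** No root [r] lies in [0, 1], so each factor can be normalized at 0 into [1 - t / r], which is
    positive on [0, 1]. *)
Lemma real_rooted_prod (g : {poly R}) p : real_rooted g -> (size g <= p.+1)%N ->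
  (forall t, 0 <= t <= 1 -> 0 < g.[t]) ->
  exists q : 'I_p -> R, (forall t, g.[t] = g.[0] * \prod_i (1 - t * q i)) /\
    (forall t i, 0 <= t <= 1 -> 0 < 1 - t * q i).
Proof.
move=> g_rr szg g_gt0; have [rs defg] := real_rooted_factor g_rr.
have g_neq0 : g != 0.
  by apply: contraTneq (g_gt0 0 _) => [->|]; rewrite ?lexx ?ler01 // horner0 ltxx.
have sz_rs : (size rs <= p)%N.
  by move: szg; rewrite defg size_scale ?lead_coef_eq0 // size_prod_XsubC.
have rs_out r : r \in rs -> r < 0 \/ 1 < r.
  move=> rrs; have gr0 : g.[r] = 0.
    by apply/eqP; rewrite defg -/(root _ r) rootZ ?lead_coef_eq0 // root_prod_XsubC.
  have [|r_ge0] := ltP r 0; first by left.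
  have [r_le1|] := leP r 1; last by right.
  by have := g_gt0 r; rewrite r_ge0 r_le1 gr0 ltxx => /(_ isT).
(* Past the last root, the default 0 and [invr0] give [q i = 0], hence a factor 1: this pads the
   product to exactly [p] factors. *)
pose q i := (nth 0 rs i)^-1.
exists (fun i => q i); split => [t|t i /andP[t_ge0 t_le1]]; last first.
  rewrite /q; have [le_i|lt_i] := leqP (size rs) i.
    by rewrite nth_default // invr0 mulr0 subr0.
  have [r_lt0|r_gt1] := rs_out _ (mem_nth 0 lt_i).
    have : (rs`_i)^-1 < 0 by rewrite invr_lt0.
    nra.
  have : (rs`_i)^-1 < 1 by rewrite invf_lt1 // (lt_trans ltr01).
  have : 0 < (rs`_i)^-1 by rewrite invr_gt0 (lt_trans ltr01).
  nra.
have -> : \prod_(i < p) (1 - t * q i) = \prod_(r <- rs) (1 - t * r^-1).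
  rewrite (big_nth 0) big_mkord.
  rewrite (big_ord_widen p (fun i => 1 - t * (rs`_i)^-1) sz_rs) [RHS]big_mkcond.
  apply: eq_bigr => i _; case: ltnP => // le_i.
  by rewrite /q nth_default // invr0 mulr0 subr0.
rewrite defg !hornerZ -mulrA; congr (_ * _).
rewrite !horner_prod -big_split /= !big_seq; apply: eq_bigr => r /rs_out r_out.
have r_neq0 : r != 0 by case: r_out; [move/lt_eqF-> | move/(lt_trans ltr01)/gt_eqF->].
by rewrite !hornerE; field.
Qed.

Lemma real_rooted_neq0 (P : {poly R}) : real_rooted P -> P != 0.
Proof.
move=> P_rr; apply/eqP => P0.
have /P_rr /eqP : root (map_poly (real_complex R) P) 'i%C.
  by rewrite P0 map_poly0 root0.
by rewrite oner_eq0.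
Qed.

(** At a positive root, a vanishing sum of nonnegative terms would force every coefficient to be 0,
    but the zero polynomial is not real-rooted. *)
Lemma root_le0 (P : {poly R}) (z : R[i]) : real_rooted P ->
  (forall k, 0 <= P`_k) -> root (map_poly (real_complex R) P) z -> z <= 0.
Proof.
move=> P_rr P_ge0 rootz; have := P_rr z rootz; case: z rootz => r s /= rootz s0.
rewrite {s}s0 in rootz *; rewrite lecE /= eqxx /= leNgt; apply/negP => r_gt0.
have /eqP := real_rooted_neq0 P_rr; apply.
move: rootz; rewrite (fmorph_root (real_complex R) P r) /root horner_coef psumr_eq0; last first.
  by move=> i _; rewrite mulr_ge0 ?exprn_ge0 // ltW.
move=> /allP P0; apply/polyP => k; rewrite coef0.
have [le_k|lt_k] := leqP (size P) k; first by rewrite nth_default.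
have := P0 (Ordinal lt_k) (mem_index_enum _); rewrite /= mulf_eq0.
by rewrite (expf_eq0 r) (gt_eqF r_gt0) andbF orbF => /eqP.
Qed.

Lemma polarize_line_real_rooted n (b : nat -> R) (x y : 'I_n -> R) :
  (forall k, 0 <= b k) ->
  real_rooted (\poly_(k < n.+1) (b k *+ 'C(n, k))) ->
  (forall i, 0 < y i) ->
  real_rooted (polarize [seq (y i)%:P + (x i)%:P * 'X | i <- enum 'I_n]
                 (fun k => (b k)%:P)).
Proof.
move=> b_ge0 b_rr y_gt0 tau; apply: contraTeq => tau_im.
have Im_tau : 'Im tau != 0 by rewrite -complexIm; apply: contraNneq tau_im => -[->].
(* For [c] the conjugate of [tau] up to sign, [c * tau] is real, so [c * (y i + x i * tau)] has
   imaginary part ['Im c * y i]. *)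
have [c c_gt0 c_tau] : exists2 c : R[i], 0 < 'Im c & 'Im (c * tau) = 0.
  have Im0 : 'Im (tau^*%R * tau) = 0.
    by apply/Creal_ImP; rewrite mulrC -normCK rpredX // normr_real.
  have [lt0|ge0] := real_ltP (Creal_Im tau) (real0 _).
    by exists (tau^*)%R; rewrite // Im_conj oppr_gt0.
  exists (- (tau^*)%R); last by rewrite mulNr raddfN /= Im0 oppr0.
  by rewrite raddfN /= Im_conj opprK lt_def Im_tau.
have ImMr (r : R) (z : R[i]) : 'Im (z * r%:C%C) = 'Im z * r%:C%C.
  have r_real : r%:C%C \is Num.real by apply/complex_realP; exists r.
  by rewrite [z * _]mulrC (ImMl r_real) [RHS]mulrC.
rewrite /root (rmorph_polarize (map_poly (real_complex R))) /=.
rewrite -[_.[tau]]/(horner_eval tau _) rmorph_polarize.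
have -> : map (horner_eval tau) (map (map_poly (real_complex R))
    [seq (y i)%:P + (x i)%:P * 'X | i <- enum 'I_n]) =
    [seq (y i)%:C%C + (x i)%:C%C * tau | i <- enum 'I_n].
  rewrite -!map_comp; apply: eq_map => i /=.
  by rewrite rmorphD rmorphM /= !map_polyC map_polyX /horner_eval !hornerE.
have ImcD (r s : R) : 'Im (c * (r%:C%C + s%:C%C * tau)) = 'Im c * r%:C%C.
  by rewrite mulrDr raddfD /= ImMr [s%:C%C * _]mulrC mulrA ImMr c_tau mul0r addr0.
apply: (polarize_neq0 (c := c) (z0 := 1)); first by rewrite mulr1.
  move=> _ /mapP[i _ ->]; rewrite ImcD mulr_gt0 //.
  by rewrite ltcR.
(* A root satisfies [z <= 0], so the imaginary part ['Im c * z] of [c * z] is at most 0 and [z] is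
   outside the half-plane. *)
move=> z z_gt0; rewrite size_map size_enum_ord; apply: contraTN z_gt0 => rootz.
have z_le0 : z <= 0.
  apply: (root_le0 b_rr) => [k|].
    by rewrite coef_poly; case: ifP => // _; rewrite mulrn_wge0.
  congr (root _ z) : rootz; apply/polyP => k.
  rewrite coef_map !coef_poly; case: ifP => _; last by rewrite raddf0.
  by rewrite /= /horner_eval map_polyC hornerC raddfMn.
have zE : (complex.Re z)%:C%C = z by exact: RRe_real (ler0_real z_le0).
rewrite -zE ImMr zE -real_leNgt ?real0 ?pmulr_rle0 //.
by apply: realM; [exact: Creal_Im | exact: ler0_real].
Qed.

End RealRooted.

(** * Concavity along a segment *)

Theorem mainTheorem2 (R : realType)
    (convolution_real_rooted : forall (p : nat) (P Q : {poly R}),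
       (1 <= p)%N -> size P = p.+1 -> size Q = p.+1 ->
       real_rooted P -> real_rooted Q ->
       real_rooted (\sum_(k < p.+1) P^`(k) * Q^`(p - k)))
    (n p : nat) (p_ge1 : (1 <= p)%N) (p_le_n : (p <= n)%N)
    (a : 'I_p.+1 -> R) (a_ge0 : forall k, 0 <= a k)
    (a_real_rooted :
       real_rooted (\sum_(k < p.+1) (a k * 'C(n, k)%:R) *: 'X^k)) :
  concave_function (@positive_orthant R n)
    (fun x : 'rV[R]_n => (\sum_(k < p.+1) a k * sigma k x) `^ (p%:R^-1)).
Proof.
move=> t x y; rewrite !inE => x_gt0 y_gt0.
rewrite !sum_sigmaE //.
set b : nat -> R := fun k => oapp a 0 (insub k).
have b_ge0 k : 0 <= b k by rewrite /b; case: insub => /=.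
have b_rr : real_rooted (\poly_(k < n.+1) (b k *+ 'C(n, k))).
  congr real_rooted : a_real_rooted.
  pose F k : {poly R} := (b k *+ 'C(n, k)) *: 'X^k.
  rewrite poly_def (eq_bigr (fun k : 'I__ => F k)) => [|k _].
    rewrite (big_ord_widen n.+1 F) // big_mkcond /=.
    apply: eq_bigr => k _; case: ifP => // /negbT k_ge.
    by rewrite /F /b insubN // mul0rn scale0r.
  by rewrite /F /b valK mulr_natr.
(* [g] is the restriction to the line through [y] (parameter 0) and [x] (parameter 1). *)
pose g : {poly R} := polarize
  [seq (y ord0 i)%:P + (x ord0 i - y ord0 i)%:P * 'X | i <- enum 'I_n]
  (fun k => (b k)%:P).
have gE u : g.[u] = polarize
    [seq y ord0 i + (x ord0 i - y ord0 i) * u | i <- enum 'I_n] b.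
  rewrite -[LHS]/(horner_eval u g) rmorph_polarize -map_comp.
  rewrite (eq_map (g := fun i => y ord0 i + (x ord0 i - y ord0 i) * u)) => [|i].
    by apply: eq_polarize => k; rewrite /= /horner_eval hornerC.
  by rewrite /= /horner_eval !hornerE.
have g_rr : real_rooted g by exact: polarize_line_real_rooted.
have [k le_kn bk_gt0] : exists2 k, (k <= n)%N & 0 < b k.
  apply: contrapT => b_le0; have /eqP := real_rooted_neq0 b_rr; apply.
  apply/polyP => k; rewrite coef_poly coef0; case: ifP => // le_kn.
  have [->|bk_neq0] := eqVneq (b k) 0; first by rewrite mul0rn.
  by case: b_le0; exists k; rewrite // lt_def bk_neq0 b_ge0.
have g_gt0 u : 0 <= u <= 1 -> 0 < g.[u].
  move=> /andP[u_ge0 u_le1]; rewrite gE.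
  apply: (polarize_gt0 (k := k)) => //; last by rewrite size_map size_enum_ord.
  by move=> _ /mapP[i _ ->]; have := x_gt0 i; have := y_gt0 i; nra.
have szg : (size g <= p.+1)%N.
  apply: size_polarize => [_ /mapP[i _ ->]|j].
    rewrite (leq_trans (size_polyD _ _)) // geq_max.
    rewrite (leq_trans (size_polyC_leq1 _)) //=.
    by rewrite (leq_trans (size_polyMleq _ _)) // size_polyX addn2 /= ltnS size_polyC_leq1.
  rewrite /b; case: insubP => [i /= lt_ip _|_]; last by rewrite size_poly0.
  by rewrite (leq_trans (size_polyC_leq1 _)) // subn_gt0.
have [q [gq q_gt0]] := real_rooted_prod g_rr szg g_gt0.
have t01 : 0 <= t%:num <= 1 by rewrite ge0 le1.
have fE u (v : 'rV[R]_n) : (forall i, v ord0 i = y ord0 i + (x ord0 i - y ord0 i) * u) ->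
    polarize [seq v ord0 i | i <- enum 'I_n] b = g.[0] * \prod_i (1 - u * q i).
  by move=> vE; rewrite -gq gE (eq_map vE).
rewrite (fE 1 x) => [|i]; last by ring.
rewrite (fE 0 y) => [|i]; last by ring.
rewrite (fE t%:num) => [|i]; last by rewrite !mxE /unstable.onem; ring.
have g0_ge0 : 0 <= g.[0] by rewrite ltW // g_gt0 // lexx ler01.
have prod_ge0 u : 0 <= u <= 1 -> 0 <= \prod_i (1 - u * q i).
  by move=> u01; rewrite prodr_ge0 // => i _; rewrite ltW // q_gt0.
have u0 : 0 <= (0 : R) <= 1 by rewrite lexx ler01.
have u1 : 0 <= (1 : R) <= 1 by rewrite lexx ler01.
(* The common factor from [g.[0]] comes out, and Mahler's inequality is applied to the factors
   [1 - q i] at [x] and 1 at [y], whose convex combination is [1 - t * q i]. *)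
rewrite !powRM ?prod_ge0 // -convN lerN2 convRE /unstable.onem.
have le_prod := geometric_mean_concave p_ge1 t01 (fun i => q_gt0 1 i u1)
  (fun i => q_gt0 0 i u0).
rewrite !(mulrCA _ (g.[0] `^ _)) -mulrDr.
rewrite ler_wpM2l ?powR_ge0 //.
rewrite (le_trans le_prod) // le_eqVlt; apply/orP; left; apply/eqP.
by congr (_ `^ _); apply: eq_bigr => i _; ring.
Qed.
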